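(* Consider the CPE-B problem in the fixed-confidence setting with $n$ base arms, $R$-sub-Gaussian rewards, decision class $\mathcal{M}$ and confidence parameter $\delta\in(0,1)$. With probability at least $1-\delta$, algorithm BLUCB returns the optimal super arm $M_*$ with sample complexity $$O\left(\sum_{e\in[n]}\frac{R^2}{(\Delta^{C}_e)^2}\ln\left(\sum_{e\in[n]}\frac{R^2 n}{(\Delta^{C}_e)^2\,\delta}\right)\right).$$
   Context: CPE-B (combinatorial pure exploration with bottleneck reward). There are $n$ base arms $[n]=\{1,\dots,n\}$. Each base arm $e$ has an unknown reward distribution with mean $w(e)$ and an $R$-sub-Gaussian tail ($R>0$): if $X$ is a random reward of $e$, then $\mathbb{E}[\exp(\lambda(X-w(e)))]\le\exp(\lambda^2R^2/2)$ for all $\lambda\in\mathbb{R}$. Write $\boldsymbol{w}=(w(1),\dots,w(n))$. A decision class $\mathcal{M}\subseteq 2^{[n]}$ of super arms (nonempty subsets of $[n]$) is given. For $M\in\mathcal{M}$ and a vector $\boldsymbol{v}\in\mathbb{R}^n$ let $\mathrm{MinW}(M,\boldsymbol{v})=\min_{e\in M}v(e)$. The optimal super arm $M_*=\operatorname{argmax}_{M\in\mathcal{M}}\mathrm{MinW}(M,\boldsymbol{w})$ is assumed unique, and $\mathrm{OPT}=\mathrm{MinW}(M_*,\boldsymbol{w})$. At each timestep the learner plays one base arm and observes an independent sample of its reward. In the fixed-confidence setting the goal is to identify $M_*$ with probability at least $1-\delta$; the sample complexity is the number of samples used. Gaps. Let $N=\{e: e\notin M_*, w(e)<\mathrm{OPT}\}$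 and $\tilde N=\{e: e\notin M_*, w(e)\ge \mathrm{OPT}\}$. Define $\Delta^{C}_e=w(e)-\max_{M\in\mathcal{M},M\ne M_*}\mathrm{MinW}(M,\boldsymbol{w})$ if $e\in M_*$; $\Delta^{C}_e=w(e)-\max_{M\in\mathcal{M}:e\in M}\mathrm{MinW}(M,\boldsymbol{w})$ if $e\in\tilde N$; $\Delta^{C}_e=\mathrm{OPT}-\max_{M\in\mathcal{M}:e\in M}\mathrm{MinW}(M,\boldsymbol{w})$ if $e\in N$. (Maximum over the empty set is $-\infty$, and $1/\infty^2=0$.) Algorithm BLUCB. $\mathcal{S}(M)$ denotes the set of all supersets of $M$ (including $M$). $\mathrm{MaxOracle}(\mathcal{F},\boldsymbol{v})$ returns an element of $\operatorname{argmax}_{M\in\mathcal{F}}\mathrm{MinW}(M,\boldsymbol{v})$. $T_t(e)$ is the number of samples of $e$ before round $t$ and $\hat w_t(e)$ their empirical mean. First play each base arm once (rounds $1,\dots,n$). Then for $t=n+1,n+2,\dots$: set $\mathrm{rad}_t(e)=R\sqrt{2\ln(4nt^3/\delta)/T_t(e)}$, $\underline{w}_t(e)=\hat w_t(e)-\mathrm{rad}_t(e)$, $\bar w_t(e)=\hat w_t(e)+\mathrm{rad}_t(e)$ for all $e$; $M_t=\mathrm{MaxOracle}(\mathcal{M},\underline{\boldsymbol{w}}_t)$; $\tilde M_t=\mathrm{MaxOracle}(\mathcal{M}\setminus\mathcal{S}(M_t),\bar{\boldsymbol{w}}_t)$. If $\mathrm{MinW}(M_t,\underline{\boldsymbol{w}}_t)\ge\mathrm{MinW}(\tilde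 M_t,\bar{\boldsymbol{w}}_t)$ (or $\mathcal{M}\setminus\mathcal{S}(M_t)=\varnothing$), stop and return $M_t$. Otherwise let $c_t\in\operatorname{argmin}_{e\in M_t}\underline{w}_t(e)$, $d_t\in\operatorname{argmin}_{e\in\tilde M_t}\underline{w}_t(e)$, $p_t\in\operatorname{argmax}_{e\in\{c_t,d_t\}}\mathrm{rad}_t(e)$, and play $p_t$.
   Formalization: The sample complexity is bounded by a universal constant times the maximum of n and the displayed quantity, since BLUCB always uses at least n samples while the displayed quantity can be below n, or even negative, when the gaps are large compared with R. *)

(* Defs.v *)
From HB Require Import structures.
From mathcomp Require Import all_boot all_order all_algebra.
From mathcomp Require Import all_classical all_reals all_analysis.

Set Implicit Arguments.
Unset Strict Implicit.
Unset Printing Implicit Defensive.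

Import Order.TTheory GRing.Theory Num.Theory.
Import numFieldNormedType.Exports.

Local Open Scope ring_scope.

Definition is_argmax {T : finType} {disp : Order.disp_t} {O : porderType disp}
    (A : {set T}) (f : T -> O) (x : T) : Prop :=
  x \in A /\ forall y, y \in A -> (f y <= f x)%O.

Definition is_argmin {T : finType} {disp : Order.disp_t} {O : porderType disp}
    (A : {set T}) (f : T -> O) (x : T) : Prop :=
  x \in A /\ forall y, y \in A -> (f x <= f y)%O.

(* Base arms are 0, ..., n - 1; super arms are sets of base arms.  MinW is
   extended-real valued, so that a minimum over the empty set is +oo and, below,
   a maximum of MinW over an empty family is -oo. *)
Definition MinW {R : realType} {n : nat} (M : {set 'I_n}) (v : 'I_n -> R)
    : \bar R :=
  \big[Order.min/+oo%E]_(e in M) (v e)%:E.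

Definition maxMinW {R : realType} {n : nat} (F : {set {set 'I_n}})
    (v : 'I_n -> R) : \bar R :=
  \big[Order.max/-oo%E]_(M in F) MinW M v.

Definition is_unique_optimum {R : realType} {n : nat} (F : {set {set 'I_n}})
    (w : 'I_n -> R) (Ms : {set 'I_n}) : Prop :=
  is_argmax F (fun M => MinW M w) Ms /\
  forall M, is_argmax F (fun M' => MinW M' w) M -> M = Ms.

(* The gap of e; it is +oo when the maximum in it ranges over no super arm. *)
Definition gapC {R : realType} {n : nat} (F : {set {set 'I_n}})
    (w : 'I_n -> R) (Ms : {set 'I_n}) (e : 'I_n) : \bar R :=
  if e \in Ms then ((w e)%:E - maxMinW [set M in F | M != Ms]%SET w)%E
  else if (MinW Ms w <= (w e)%:E)%E
  then ((w e)%:E - maxMinW [set M in F | e \in M]%SET w)%E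
  else (MinW Ms w - maxMinW [set M in F | e \in M]%SET w)%E.

(* x |-> 1 / x ^ 2, with 1 / oo ^ 2 = 0. *)
Definition inv_sq {R : realType} (x : \bar R) : R :=
  if x is r%:E then (r ^+ 2)^-1 else 0.

Definition has_mean {R : realType} (nu : probability (measurableTypeR R) R)
    (m : R) : Prop :=
  nu.-integrable [set: measurableTypeR R] (fun x : measurableTypeR R => x%:E) /\
  (\int[nu]_x x%:E)%E = m%:E.

(* sg-sub-Gaussian tail around m. *)
Definition sub_gaussian {R : realType} (nu : probability (measurableTypeR R) R)
    (m sg : R) : Prop :=
  forall lam : R,
    (\int[nu]_x (expR (lam * (x - m)))%:E
       <= (expR (lam ^+ 2 * sg ^+ 2 / 2))%:E)%E.

(* Mutual independence: product rule over all finite subfamilies. *)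
Definition mutually_independent {R : realType} {d : measure_display}
    {Omega : measurableType d} (P : probability Omega R) {I : eqType}
    (X : I -> {RV P >-> R}) : Prop :=
  forall (J : seq I) (A : I -> set R), uniq J ->
    (forall i, i \in J -> measurable (A i)) ->
    P [set om | forall i, i \in J -> A i (X i om)]%classic =
    (\prod_(i <- J) P (X i @^-1` A i)%classic)%E.

(* X (e, k) is the reward observed when base arm e is played for the (k+1)-th
   time. *)
Definition iid_samples {R : realType} {d : measure_display}
    {Omega : measurableType d} (P : probability Omega R) {n : nat}
    (nu : 'I_n -> probability (measurableTypeR R) R)
    (X : 'I_n * nat -> {RV P >-> R}) : Prop :=
  mutually_independent X /\
  forall e k (A : set (measurableTypeR R)),
    measurable A -> distribution P (X (e, k)) A = nu e A.

(* The choices made by the learner in each round t >= 1: the base arm p_t it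
   plays and the auxiliary M_t, ~M_t, c_t, d_t (meaningful only for t > n).
   Values at round 0 and from the stopping round on are irrelevant. *)
Record trajectory (n : nat) := Trajectory {
  run_M  : nat -> {set 'I_n};
  run_Mt : nat -> {set 'I_n};
  run_c  : nat -> 'I_n;
  run_d  : nat -> 'I_n;
  run_p  : nat -> 'I_n }.

Section BLUCB.
Context {R : realType} {n : nat}.
Context (F : {set {set 'I_n}}) (sg delta : R).
(* x e k is the (k+1)-th reward of e. *)
Context (x : 'I_n -> nat -> R) (z : trajectory n).

Definition num_samples (t : nat) (e : 'I_n) : nat :=
  (\sum_(1 <= s < t) (run_p z s == e))%N.

Definition emp_mean (t : nat) (e : 'I_n) : R :=
  (\sum_(k < num_samples t e) x e k) / (num_samples t e)%:R.

Definition rad (t : nat) (e : 'I_n) : R :=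
  sg * Num.sqrt (2 * ln (4 * n%:R * t%:R ^+ 3 / delta) / (num_samples t e)%:R).

Definition lcb (t : nat) (e : 'I_n) : R := emp_mean t e - rad t e.

Definition ucb (t : nat) (e : 'I_n) : R := emp_mean t e + rad t e.

Definition rivals (t : nat) : {set {set 'I_n}} :=
  [set M in F | ~~ (run_M z t \subset M)]%SET.

Definition stop_test (t : nat) : Prop :=
  rivals t = finset.set0 \/
  (MinW (run_Mt z t) (ucb t) <= MinW (run_M z t) (lcb t))%E.

Definition running (t : nat) : Prop :=
  forall s : nat, (n < s < t)%N -> ~ stop_test s.

(* Any tie-breaking is allowed in the oracle calls and in c_t, d_t, p_t, as is
   any order of play in the initial rounds. *)
Definition BLUCB_run : Prop :=
  (forall e, num_samples n.+1 e = 1%N) /\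
  forall t : nat, (n < t)%N -> running t ->
    [/\ is_argmax F (fun M => MinW M (lcb t)) (run_M z t),
        rivals t <> finset.set0 ->
          is_argmax (rivals t) (fun M => MinW M (ucb t)) (run_Mt z t)
      & ~ stop_test t ->
          [/\ is_argmin (run_M z t) (lcb t) (run_c z t),
              is_argmin (run_Mt z t) (lcb t) (run_d z t)
            & is_argmax [set run_c z t; run_d z t]%SET (rad t) (run_p z t)]].

(* The run stops, returns M, and has used N samples: it stops in round N + 1,
   one sample having been taken in each of the rounds 1, ..., N. *)
Definition BLUCB_returns (M : {set 'I_n}) (N : nat) : Prop :=
  [/\ (n <= N)%N, running N.+1, stop_test N.+1 & run_M z N.+1 = M].

End BLUCB.

(* This quantity can be smaller than n, even 0 or negative, when the gaps are
   large compared with sg (for F = [set Ms], all gaps are +oo), whereas n samples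
   are always taken in the initial rounds; so it can bound the number of samples
   up to a universal constant only when it is at least n. *)
Definition complexity_bound {R : realType} {n : nat} (sg delta : R)
    (Delta : 'I_n -> \bar R) : R :=
  (\sum_(e < n) sg ^+ 2 * inv_sq (Delta e)) *
  ln (\sum_(e < n) sg ^+ 2 * n%:R * inv_sq (Delta e) / delta).

(* Main.v *)
(* Idea.  Let E be the event that, for every arm e and every k >= 1, the mean of
   the first k rewards of e is within sg * sqrt (2 ln (4 n (k+1)^3 / delta) / k)
   of w e.  Since an arm has been played at most t - 1 times before round t, on E
   all the intervals [lcb t e, ucb t e] contain w e; the Chernoff bound and
   sum_k 1/(k+1)^3 <= 1 give P E >= 1 - delta.  Defining E from the rewards alone
   makes it measurable whatever the tie-breaking of the learner.
   On E, put L = MinW M_t lcb and let r be the radius of the arm p played in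
   round t.  Then M_t and ~M_t are distinct, both have MinW > L - 2r, one of them
   contains p, w p <= L + 2r, and OPT <= L + 2r when p is not in M_*; in each case
   of the definition, the gap of p is < 4r.  So an arm is played at most
   1 + 32 (sg / gap)^2 ln (4 n N^3 / delta) times in N rounds, and solving
   N <= n + 32 H ln (4 n N^3 / delta) with H = sum_e (sg / gap e)^2 bounds N. *)
Require Import Defs.
From mathcomp Require Import all_boot all_order all_algebra.
From mathcomp Require Import all_classical all_reals all_analysis.
From mathcomp Require Import measurable_realfun ring lra.
Import Order.TTheory GRing.Theory Num.Theory.
Import numFieldNormedType.Exports.
Local Open Scope ring_scope.

(** * From indicators to nonnegative functions under an integral *)

Section indicators_to_functions.
Local Open Scope classical_set_scope.
Local Open Scope ereal_scope.
Import HBNNSimple.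
Context d (T : measurableType d) (R : realType).
Context (P : {measure set T -> \bar R}) (X : {mfun T >-> R}).
Context (mu : {measure set R -> \bar R}).
Context (G : T -> R) (c : R).
Hypothesis mG : measurable_fun setT G.
Hypothesis G_ge0 : forall x, (0 <= G x)%R.
Hypothesis GE : forall A : set R, measurable A ->
  \int[P]_x (G x * \1_A (X x))%:E = c%:E * mu A.

Let integral_nnsfun (g : {nnsfun R >-> R}) :
  \int[P]_x (G x * g (X x))%:E = c%:E * \int[mu]_y (g y)%:E.
Proof.
have mind (r : R) : measurable_fun setT
    ((fun x => (G x * \1_(g @^-1` [set r]) (X x))%:E) : T -> \bar R).
  apply/measurable_EFinP/measurable_funM => //.
  by apply: measurableT_comp => //; exact: measurable_indic.
under eq_integral.
  move=> x _; rewrite fimfunE EFinM -fsumEFin// ge0_mule_fsumr; last first.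
    by move=> r; rewrite EFinM nnfun_muleindic_ge0.
  under eq_fsbigr do rewrite -EFinM mulrCA EFinM.
  over.
rewrite ge0_integral_fsum//=; last 2 first.
  - by move=> r; apply: emeasurable_funM => //; exact: mind.
  - move=> r x _; have := nnfun_muleindic_ge0 g r (X x).
    by rewrite -!EFinM !lee_fin mulrCA => h; exact: mulr_ge0.
rewrite [in RHS](eq_integral (fun y =>
   \sum_(r \in range g) (r * \1_(g @^-1` [set r]) y)%:E)); last first.
  by move=> y _; rewrite fimfunE -fsumEFin.
rewrite ge0_integral_fsum//=; last 2 first.
  - by move=> r; apply/measurable_EFinP/measurableT_comp.
  - by move=> r x _; rewrite EFinM nnfun_muleindic_ge0.
rewrite ge0_mule_fsumr; last first.
  by move=> r; apply: integral_ge0 => y _; rewrite EFinM nnfun_muleindic_ge0.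
apply: eq_fsbigr => r /[!inE] -[y _ <-].
rewrite ge0_integralZl//; last 2 first.
  - by move=> x _; rewrite lee_fin mulr_ge0.
  - by rewrite lee_fin.
rewrite GE// integralZl_indic_nnsfun// integral_indic// setIT.
by rewrite muleCA.
Qed.

(** Hypothesis [GE] says that the measure with density [G] with respect to [P], pushed forward along
    [X], is [c] times [mu]. Linearity over level sets gives simple functions, and monotone
    convergence on both sides gives every measurable [h >= 0]. *)
Lemma integral_mul_indic_ext (h : R -> R) : measurable_fun setT h ->
    (forall y, (0 <= h y)%R) ->
  \int[P]_x (G x * h (X x))%:E = c%:E * \int[mu]_y (h y)%:E.
Proof.
move=> mh h0.
have mEh : measurable_fun [set: R] (EFin \o h : R -> \bar R)
  by exact/measurable_EFinP.
pose f_ := nnsfun_approx measurableT mEh.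
have fcvg y : (f_ n y)%:E @[n --> \oo] --> (h y)%:E.
  apply: (@cvg_nnsfun_approx _ _ _ _ measurableT _ mEh) => // x _.
  by rewrite lee_fin.
have fnd y : {homo (fun n => f_ n y) : a b / (a <= b)%N >-> (a <= b)%R}.
  by move=> a b ab; exact/lefP/nd_nnsfun_approx.
transitivity (limn (fun n => \int[P]_x (G x * f_ n (X x))%:E)).
  rewrite -monotone_convergence//=.
  - apply: eq_integral => x _; apply/esym/cvg_lim => //=.
    under eq_fun do rewrite EFinM.
    by rewrite EFinM; apply: cvgeZl => //.
  - move=> n; apply/measurable_EFinP/measurable_funM => //.
    exact: measurableT_comp.
  - by move=> n x _; rewrite lee_fin mulr_ge0.
  - by move=> x _ a b ab; rewrite lee_fin ler_wpM2l//; exact: fnd.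
rewrite (_ : \int[mu]_y _ = limn (fun n => \int[mu]_y (f_ n y)%:E)); last first.
  rewrite -monotone_convergence//=.
  - by apply: eq_integral => x _; apply/esym/cvg_lim.
  - by move=> n; exact/measurable_EFinP.
  - by move=> n x _; rewrite lee_fin.
  - by move=> x _ a b ab; rewrite lee_fin//; exact: fnd.
rewrite -limeMl//.
  by congr (limn _); apply/funext => n /=; rewrite integral_nnsfun.
apply/ereal_nondecreasing_is_cvgn => a b ab; apply: ge0_le_integral => //.
- by move=> x _; rewrite lee_fin.
- exact/measurable_EFinP.
- exact/measurable_EFinP.
- by move=> x _; rewrite lee_fin; exact: fnd.
Qed.

End indicators_to_functions.

(** * Expectation of a product of independent variables *)

Section independence.
Local Open Scope classical_set_scope.
Local Open Scope ereal_scope.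
Context {R : realType} {d : measure_display} {Omega : measurableType d}.
Context {P : probability Omega R} {I : eqType} {X : I -> {RV P >-> R}}.
Hypothesis indep : mutually_independent X.

Let cylinder (J : seq I) (A : I -> set R) : set Omega :=
  [set om | forall i, i \in J -> A i (X i om)].

Let measurable_cylinder J A : (forall i, i \in J -> measurable (A i)) ->
  measurable (cylinder J A).
Proof.
move=> mA; rewrite (_ : cylinder J A = \bigcap_(i in [set` J]) (X i @^-1` A i)).
  apply: fin_bigcap_measurable => [|i iJ]; first exact: finite_seq.
  rewrite -[X in measurable X]setTI.
  exact: (measurable_funP (X i) measurableT _ (mA i iJ)).
by apply/seteqP; split.
Qed.

Context {f : I -> R -> R} {m : I -> R}.
Hypothesis mf : forall i, measurable_fun setT (f i).
Hypothesis f_ge0 : forall i y, (0 <= f i y)%R.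
Hypothesis fE : forall i, \int[P]_om (f i (X i om))%:E = (m i)%:E.

(* Carrying the indicator of further coordinates through the induction lets each
   factor be turned from an indicator into a function independently. *)
Let integral_prod_cylinder (J K : seq I) (A : I -> set R) : uniq (J ++ K) ->
    (forall i, i \in K -> measurable (A i)) ->
  \int[P]_om ((\prod_(i <- J) f i (X i om)) * \1_(cylinder K A) om)%:E =
  (\prod_(i <- J) m i)%:E * P (cylinder K A).
Proof.
elim: J K A => [|j J IH] K A uJK mA.
  rewrite big_nil mul1e; under eq_integral do rewrite big_nil mul1r.
  by rewrite integral_indic ?setIT//; exact: measurable_cylinder.
pose G om := ((\prod_(i <- J) f i (X i om)) * \1_(cylinder K A) om)%R.
pose c := ((\prod_(i <- J) m i) * fine (P (cylinder K A)))%R.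
have cE : c%:E = (\prod_(i <- J) m i)%:E * P (cylinder K A).
  by rewrite EFinM fineK// fin_num_measure//; exact: measurable_cylinder.
have mG : measurable_fun setT G.
  apply: measurable_funM; last exact/measurable_indic/measurable_cylinder.
  by apply: measurable_prod => i _; exact: measurableT_comp.
have G_ge0 om : (0 <= G om)%R.
  by rewrite mulr_ge0// prodr_ge0.
have jK : j \notin K.
  by move: uJK => /= /andP[+ _]; rewrite mem_cat negb_or => /andP[].
have GE (B : set R) : measurable B ->
    \int[P]_om (G om * \1_B (X j om))%:E = c%:E * distribution P (X j) B.
  (* The condition that coordinate [j] lies in [B] is one more cylinder condition; it does not clash
     with [A] because [j] is not in [K]. *)
  move=> mB; pose A' i := if i == j then B else A i.
  have mA' i : i \in j :: K -> measurable (A' i).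
    by rewrite inE /A'; case: eqVneq => //= _ /mA.
  have A'A : cylinder (j :: K) A' = (X j @^-1` B) `&` cylinder K A.
    apply/seteqP; split => om /=.
      move=> h; split; first by have := h j (mem_head _ _); rewrite /A' eqxx.
      move=> i iK; have := h i; rewrite inE iK orbT => /(_ isT).
      by rewrite /A'; case: eqVneq => // ij; move: jK; rewrite -ij iK.
    move=> [hj hK] i; rewrite inE /A'; case: eqVneq => [->//|_ /= ].
    exact: hK.
  have PA' : P (cylinder (j :: K) A') =
      distribution P (X j) B * P (cylinder K A).
    have uK : uniq K by move: uJK; rewrite cat_uniq => /and3P[].
    rewrite /cylinder indep//=; last by rewrite jK.
    rewrite big_cons [X in P (_ @^-1` X)]/A' eqxx indep//.
    congr (_ * _); apply: eq_big_seq => i iK.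
    by rewrite /A'; case: eqVneq => // ij; move: jK; rewrite -ij iK.
  rewrite cE -muleA [P _ * _]muleC -PA' -IH//; last first.
    by rewrite (uniq_catCA J [:: j] K).
  apply: eq_integral => om _; rewrite /G A'A indicI /= -mulrA.
  by rewrite [(_ * \1_B _)%R]mulrC.
have /= := @integral_mul_indic_ext _ _ _ P (X j) (distribution P (X j)) G c
  mG G_ge0 GE (f j) (mf j) (f_ge0 j).
rewrite ge0_integral_distribution//=; last 2 first.
- exact/measurable_EFinP.
- by move=> y; rewrite lee_fin.
rewrite fE cE big_cons EFinM muleAC [X in X * _]muleC => <-.
by apply: eq_integral => om _; rewrite /G big_cons -mulrA mulrC.
Qed.

Lemma independent_integral_prod (J : seq I) : uniq J ->
  \int[P]_om (\prod_(i <- J) f i (X i om))%:E = (\prod_(i <- J) m i)%:E.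
Proof.
move=> uJ; have := @integral_prod_cylinder J [::] (fun=> setT).
rewrite cats0 (_ : cylinder _ _ = setT); last by apply/seteqP; split.
rewrite probability_setT mule1 => /(_ uJ) <-//.
by apply: eq_integral => om _; rewrite indicT mulr1.
Qed.

End independence.

(** * Chernoff bounds for sums of sub-Gaussian variables *)

Section subgaussian_sums.
Local Open Scope classical_set_scope.
Local Open Scope ereal_scope.
Context {R : realType} {d : measure_display} {Omega : measurableType d}.
Context {P : probability Omega R} {I : eqType} {X : I -> {RV P >-> R}}.
Hypothesis indep : mutually_independent X.
Context {w : I -> R} {sg : R}.
Hypothesis sg_gt0 : (0 < sg)%R.
Hypothesis X_subgaussian : forall i lam,
  \int[P]_om (expR (lam * (X i om - w i)))%:E <= (expR (lam ^+ 2 * sg ^+ 2 / 2))%:E.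

Let S (J : seq I) om : R := (\sum_(i <- J) (X i om - w i))%R.

Let mS J : measurable_fun setT (S J).
Proof. by apply: measurable_sum => i; exact: measurable_funB. Qed.

(** By independence the moment generating function of the sum is the product of those of its terms,
    each at most [expR (lam ^+ 2 * sg ^+ 2 / 2)]. *)
Lemma mgf_sum_le (J : seq I) lam : uniq J ->
  \int[P]_om (expR (lam * S J om))%:E <=
  (expR ((size J)%:R * (lam ^+ 2 * sg ^+ 2 / 2)))%:E.
Proof.
move=> uJ; pose f i y := expR (lam * (y - w i)).
pose m i := fine (\int[P]_om (f i (X i om))%:E).
have mf i : measurable_fun setT (f i).
  apply: measurableT_comp => //; apply: measurable_funM => //.
  exact: measurable_funB.
have mE i : \int[P]_om (f i (X i om))%:E = (m i)%:E.
  rewrite fineK// ge0_fin_numE; last first.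
    by apply: integral_ge0 => om _; rewrite lee_fin expR_ge0.
  exact: le_lt_trans (X_subgaussian i lam) (ltry _).
under eq_integral.
  move=> om _; rewrite /S mulr_sumr expR_sum.
  over.
rewrite (@independent_integral_prod _ _ _ P I X indep f m)//; last first.
  by move=> i y; exact: expR_ge0.
rewrite lee_fin expRM_natl -(count_predT J) -iter_mulr_1 -big_const_seq.
apply: ler_prod => i _; rewrite -!lee_fin -mE X_subgaussian andbT.
by apply: integral_ge0 => om _; rewrite lee_fin expR_ge0.
Qed.

(** Markov's inequality for [expR (lam * S J om)]. The sign of [lam] is left free, so that both
    tails are covered. *)
Let chernoff_sum (J : seq I) lam a : uniq J ->
  P [set om | (a <= lam * S J om)%R] <=
  (expR ((size J)%:R * (lam ^+ 2 * sg ^+ 2 / 2) - a))%:E.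
Proof.
move=> uJ; set A := [set om | _].
have mA : measurable A.
  rewrite (_ : A = (fun om => lam * S J om)%R @^-1` `[a, +oo[); last first.
    by apply/seteqP; split => om /=; rewrite in_itv/= andbT.
  by rewrite -[X in measurable X]setTI; apply: measurable_funM.
rewrite expRD EFinM expRN lee_pdivlMr ?expR_gt0//.
apply: le_trans _ (mgf_sum_le J lam uJ).
rewrite muleC -(setIT A) -integral_indic// -ge0_integralZl//; last first.
  exact/measurable_EFinP/measurable_indic.
apply: ge0_le_integral => //.
- by apply/measurable_EFinP/measurable_funM => //; exact: measurable_indic.
- apply/measurable_EFinP; apply: measurableT_comp => //.
  exact: measurable_funM.
move=> om _; rewrite -EFinM lee_fin indicE.
have [|_] := boolP (om \in A); last by rewrite mulr0 expR_ge0.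
by rewrite inE /A/= mulr1 ler_expR.
Qed.

(** The choice [lam = r / (k * sg ^+ 2)] minimises the Chernoff exponent
    [k * (lam ^+ 2 * sg ^+ 2 / 2) - lam * r]; the two tails come from [lam] and [- lam], whence the
    factor 2. *)
Lemma subgaussian_deviation (J : seq I) (r : R) :
    uniq J -> (0 < size J)%N -> (0 < r)%R ->
  P [set om | (r <= `|\sum_(i <- J) (X i om - w i)|)%R] <=
  (2 * expR (- (r ^+ 2 / (2 * (size J)%:R * sg ^+ 2))))%:E.
Proof.
move=> uJ J0 r0; pose k : R := (size J)%:R; pose lam := (r / (k * sg ^+ 2))%R.
have k0 : (0 < k)%R by rewrite ltr0n.
have lam0 : (0 < lam)%R by rewrite divr_gt0// mulr_gt0// exprn_gt0.
pose A l := [set om | (lam * r <= l * S J om)%R].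
have mA l : measurable (A l).
  rewrite (_ : A l = (fun om => l * S J om)%R @^-1` `[(lam * r)%R, +oo[); last first.
    by apply/seteqP; split => om /=; rewrite in_itv/= andbT.
  by rewrite -[X in measurable X]setTI; apply: measurable_funM.
have PA l : (l ^+ 2 = lam ^+ 2)%R ->
    P (A l) <= (expR (- (r ^+ 2 / (2 * k * sg ^+ 2))))%:E.
  move=> l2; apply: (le_trans (chernoff_sum _ _ _ uJ)).
  rewrite lee_fin ler_expR l2 -/k le_eqVlt; apply/orP; left; apply/eqP.
  rewrite /lam; field; rewrite !gt_eqF//.
rewrite (_ : [set om | _] = A lam `|` A (- lam)%R); last first.
  apply/seteqP; split => om; rewrite /A/= mulNr -mulrN !ler_pM2l//;
    rewrite real_ler_normr ?num_real//.
    by move=> /orP.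
  by move=> /orP.
apply: (le_trans (measureU2 _ _ _)) => //.
rewrite mulr_natl mulr2n EFinD; apply: leeD; apply: PA => //.
by rewrite sqrrN.
Qed.

End subgaussian_sums.

(** * Probability of the confidence event *)

Section confidence_event.
Local Open Scope classical_set_scope.
Context {R : realType} {d : measure_display} {Omega : measurableType d}.
Context {P : probability Omega R} {n : nat} {X : 'I_n * nat -> {RV P >-> R}}.
Context {w : 'I_n -> R} {sg delta : R}.
Hypothesis sg_gt0 : 0 < sg.
Hypothesis delta_gt0 : 0 < delta.
Hypothesis delta_lt1 : delta < 1.
Hypothesis indep : mutually_independent X.
Hypothesis X_subgaussian : forall i lam,
  (\int[P]_om (expR (lam * (X i om - w i.1)))%:E <=
   (expR (lam ^+ 2 * sg ^+ 2 / 2))%:E)%E.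

Let L (k : nat) : R := ln (4 * n%:R * k.+1%:R ^+ 3 / delta).

Let L_gt0 (e : 'I_n) k : 0 < L k.
Proof.
have n1 : 1 <= n%:R :> R by rewrite ler1n; exact: leq_ltn_trans (ltn_ord e).
have k1 : 1 <= k.+1%:R ^+ 3 :> R by rewrite exprn_ege1// ler1n.
apply: ln_gt0; rewrite ltr_pdivlMr// mul1r (lt_le_trans delta_lt1)//.
nra.
Qed.

(** Failure of the confidence inequality after [k] rewards, multiplied by [k] so that it concerns a
    sum. *)
Let deviation (k : nat) (e : 'I_n) : set Omega :=
  [set om | sg * Num.sqrt (2 * k%:R * L k) <=
            `|\sum_(i <- [seq (e, j) | j <- iota 0 k]) (X i om - w i.1)|].

Let bad k : set Omega := \big[setU/set0]_(e < n) deviation k.+1 e.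

Let measurable_deviation k e : measurable (deviation k e).
Proof.
pose S om := `|\sum_(i <- [seq (e, j) | j <- iota 0 k]) (X i om - w i.1)|.
rewrite (_ : deviation k e =
    S @^-1` `[sg * Num.sqrt (2 * k%:R * L k), +oo[); last first.
  by apply/seteqP; split => om /=; rewrite in_itv/= andbT.
rewrite -[X in measurable X]setTI; suff : measurable_fun setT S by apply.
apply: measurableT_comp => //; apply: measurable_sum => i.
exact: measurable_funB.
Qed.

Let measurable_bad k : measurable (bad k).
Proof. exact: bigsetU_measurable. Qed.

(** The threshold is chosen so that the Chernoff exponent is exactly [- L k]. *)
Let P_deviation k e : (0 < k)%N ->
  (P (deviation k e) <= (delta / (2 * n%:R * k.+1%:R ^+ 3))%:E)%E.
Proof.
move=> k0; pose J := [seq (e, j) | j <- iota 0 k].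
have uJ : uniq J by rewrite map_inj_uniq ?iota_uniq// => i j [].
have sJ : size J = k by rewrite size_map size_iota.
have k0R : 0 < k%:R :> R by rewrite ltr0n.
have n0R : 0 < n%:R :> R by rewrite ltr0n; exact: leq_ltn_trans (ltn_ord e).
have r0 : 0 < sg * Num.sqrt (2 * k%:R * L k).
  by rewrite mulr_gt0// sqrtr_gt0 mulr_gt0 ?(L_gt0 e)// mulr_gt0.
have J0 : (0 < size J)%N by rewrite sJ.
apply: (le_trans (subgaussian_deviation indep sg_gt0 X_subgaussian J _ uJ J0 r0)).
rewrite lee_fin sJ exprMn sqr_sqrtr; last first.
  by rewrite ltW// mulr_gt0 ?(L_gt0 e)// mulr_gt0.
rewrite (_ : _ / _ = L k); last by field; rewrite !gt_eqF.
rewrite expRN lnK; last first.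
  by rewrite posrE divr_gt0// mulr_gt0// ?mulr_gt0// exprn_gt0.
rewrite le_eqVlt; apply/orP; left; apply/eqP; field.
by rewrite !gt_eqF//= -natr1 addrC natr1 ltr0n.
Qed.

(** A union bound over the arms gives at most [delta / (2 * (k + 2) ^ 3)], which is weakened to a
    form that telescopes in [k]. *)
Let P_bad k : (P (bad k) <= (delta * (k.+1%:R^-1 - k.+2%:R^-1))%:E)%E.
Proof.
have [n0|n0] := posnP n.
  rewrite /bad big1; last by move=> e; have := ltn_ord e; rewrite {2}n0.
  rewrite measure0 lee_fin pmulr_rge0// subr_ge0 lef_pV2 ?posrE ?ltr0n//.
  by rewrite ler_nat.
apply: (@le_trans _ _ (\sum_(e < n) (delta / (2 * n%:R * k.+2%:R ^+ 3))%:E)%E).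
  suff [] : measurable (bad k) /\ (P (bad k) <=
    \sum_(e < n) (delta / (2 * n%:R * k.+2%:R ^+ 3))%:E)%E by [].
  rewrite /bad; elim/big_ind2 : _ => [|A x B y [mA Ax] [mB By]|e _].
  - by rewrite measure0.
  - split; first exact: measurableU.
    exact: le_trans (measureU2 _ mA mB) (leeD Ax By).
  - by split; [|exact: P_deviation].
rewrite sumEFin lee_fin sumr_const card_ord -[leLHS]mulr_natl.
have n0R : 0 < n%:R :> R by rewrite ltr0n.
have k0 : 0 <= k%:R :> R by [].
rewrite (_ : n%:R * _ = delta / 2 * (k.+2%:R ^+ 3)^-1); last first.
  by field; rewrite !gt_eqF// -addn2 natrD ltr_wpDl.
rewrite (_ : _ - _ = (k.+1%:R * k.+2%:R)^-1); last first.
  rewrite -[k.+2%:R]natr1 -[k.+1%:R]natr1; field.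
  by rewrite !gt_eqF// ltr_wpDl//; lra.
rewrite -mulrA ler_pM2l// -invfM lef_pV2 ?posrE ?mulr_gt0 ?exprn_gt0 ?ltr0n//.
rewrite -[k.+2%:R]natr1 -[k.+1%:R]natr1.
nra.
Qed.

Lemma confidence_event : exists E : set Omega,
  [/\ measurable E, ((1 - delta)%:E <= P E)%E
    & forall om, E om -> forall e (k : nat), (0 < k)%N ->
        `|(\sum_(j < k) X (e, val j) om) / k%:R - w e| <=
        sg * Num.sqrt (2 * ln (4 * n%:R * k.+1%:R ^+ 3 / delta) / k%:R)].
Proof.
have mB : measurable (\bigcup_k bad k) by exact: bigcupT_measurable.
exists (~` \bigcup_k bad k); split; first exact: measurableC.
  rewrite probability_setC// EFinB leeB//.
  apply: (le_trans (measure_sigma_subadditive _ _ _ (subset_refl _))) => //.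
  apply: lime_le; first exact: is_cvg_nneseries.
  apply: nearW => N; rewrite big_mkord.
  apply: (@le_trans _ _ (\sum_(k < N) (delta * (k.+1%:R^-1 - k.+2%:R^-1))%:E)%E).
    by apply: lee_sum => k _; exact: P_bad.
  rewrite sumEFin lee_fin -mulr_sumr ler_piMr ?(ltW delta_gt0)//.
  rewrite -(big_mkord predT (fun k => k.+1%:R^-1 - k.+2%:R^-1)).
  (* The partial sum is [1 - 1 / (N + 1)], hence at most 1. *)
  rewrite (telescope_sumr_eq (fun k => - k.+1%:R^-1))//; last first.
    by move=> k _; rewrite opprK addrC.
  by rewrite opprK invr1 gerDr oppr_le0 invr_ge0.
move=> om Eom e [//|k] _.
have nd : ~ deviation k.+1 e om.
  move=> devom; apply: Eom; exists k => //.
  by rewrite /bad (bigD1 e)//=; left.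
move: nd => /negP; rewrite -ltNge big_map => /ltW.
have k0 : 0 < k.+1%:R :> R by rewrite ltr0n.
have -> : \sum_(j <- iota 0 k.+1) (X (e, j) om - w (e, j).1) =
    \sum_(j < k.+1) X (e, val j) om - k.+1%:R * w e.
  rewrite -[iota 0 k.+1]/(index_iota 0 k.+1) big_mkord sumrB /=.
  by rewrite sumr_const card_ord mulr_natl.
have -> : 2 * k.+1%:R * L k.+1 =
    k.+1%:R ^+ 2 * (2 * ln (4 * n%:R * k.+2%:R ^+ 3 / delta) / k.+1%:R).
  by rewrite /L; field; rewrite gt_eqF.
rewrite sqrtrM ?sqr_ge0// sqrtr_sqr (gtr0_norm k0) mulrCA => h.
rewrite -(ler_pM2l k0); apply: le_trans h.
by rewrite -[X in X * `|_|](gtr0_norm k0) -normrM mulrBr mulrCA divff ?mulr1.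
Qed.

End confidence_event.

(** * Order properties of the bottleneck value *)

Section bottleneck.
Context {R : realType} {n : nat}.
Implicit Types (M : {set 'I_n}) (F : {set {set 'I_n}}) (v : 'I_n -> R) (e : 'I_n).
Local Open Scope ereal_scope.

Lemma MinW_le M v e : e \in M -> MinW M v <= (v e)%:E.
Proof. by move=> eM; exact: bigmin_le_cond. Qed.

Lemma le_MinW M v (a : \bar R) :
  (forall e, e \in M -> a <= (v e)%:E) -> a <= MinW M v.
Proof. by move=> av; apply: le_bigmin => //; exact: leey. Qed.

Lemma ltNy_MinW M v : -oo < MinW M v.
Proof. by apply: lt_bigmin => // e _; exact: ltNyr. Qed.

Lemma MinW_mono M v v' : (forall e, (v e <= v' e)%R) -> MinW M v <= MinW M v'.
Proof.
move=> vv'; apply: le_MinW => e eM.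
by apply: (le_trans (MinW_le _ _ _ eM)); rewrite lee_fin.
Qed.

Lemma MinW_subset M M' v : M \subset M' -> MinW M' v <= MinW M v.
Proof.
by move=> /fintype.subsetP MM'; apply: le_MinW => e /MM'; exact: MinW_le.
Qed.

Lemma MinW_argmin M v c : is_argmin M v c -> MinW M v = (v c)%:E.
Proof.
move=> [cM vc]; apply/eqP; rewrite eq_le MinW_le//=.
by apply: le_MinW => e eM; rewrite lee_fin; exact: vc.
Qed.

Lemma le_maxMinW F M v : M \in F -> MinW M v <= maxMinW F v.
Proof.
by move=> MF; exact: (@le_bigmax_cond _ _ _ _ M (mem F) (fun M => MinW M v)).
Qed.

Lemma maxMinW_lt F v (a : \bar R) : -oo < a ->
  (forall M, M \in F -> MinW M v < a) -> maxMinW F v < a.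
Proof. exact: bigmax_lt. Qed.

End bottleneck.

(** * Deterministic analysis of one round with valid confidence bounds *)

Section unique_optimum.
Local Open Scope ereal_scope.
Context {R : realType} {n : nat} {F : {set {set 'I_n}}} {w : 'I_n -> R}.
Context {Ms : {set 'I_n}}.
Hypothesis optMs : is_unique_optimum F w Ms.

Lemma optimum_lt M : M \in F -> M != Ms -> MinW M w < MinW Ms w.
Proof.
move=> MF; apply: contraNT; rewrite -leNgt => le_opt; apply/eqP.
apply: optMs.2; split=> // M' M'F; apply: (le_trans _ le_opt).
exact: optMs.1.2.
Qed.

Lemma optimum_eq M : M \in F -> MinW Ms w <= MinW M w -> M = Ms.
Proof.
move=> MF; rewrite leNgt => /negP h; apply/eqP; apply: contra_notT h.
exact: optimum_lt.
Qed.

(** Each maximum in the gap ranges over super arms other than [Ms], since a super arm containing an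
    arm outside [Ms] differs from it; uniqueness puts all their values strictly below the
    optimum. *)
Lemma gapC_gt0 e : 0 < gapC F w Ms e.
Proof.
have ltNy := ltNy_MinW Ms w.
have ltOPT : e \notin Ms -> maxMinW [set M in F | e \in M]%SET w < MinW Ms w.
  move=> eMs; apply: maxMinW_lt => // M; rewrite inE => /andP[MF eM].
  by apply: optimum_lt => //; apply: contraNneq eMs => <-.
rewrite /gapC; case: ifPn => [eMs|/ltOPT ?]; last case: ifPn => [OPTe|_].
- rewrite sube_gt0; apply: (lt_le_trans _ (MinW_le _ _ _ eMs)).
  by apply: maxMinW_lt => // M; rewrite inE => /andP[]; exact: optimum_lt.
- by rewrite sube_gt0; exact: lt_le_trans OPTe.
- by rewrite sube_gt0.
Qed.

Context {l u : 'I_n -> R}.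
Hypothesis lw : forall e, (l e <= w e)%R.
Hypothesis wu : forall e, (w e <= u e)%R.
Context {M Mt : {set 'I_n}}.
Let rivals := [set M' in F | ~~ (M \subset M')]%SET.
Hypothesis argM : is_argmax F (fun M => MinW M l) M.
Hypothesis argMt : rivals <> finset.set0 -> is_argmax rivals (fun M => MinW M u) Mt.

Let MF : M \in F. Proof. exact: argM.1. Qed.

Let lMw : MinW M l <= MinW M w. Proof. exact: MinW_mono. Qed.

Let subset_optimum : M \subset Ms -> M = Ms.
Proof. by move=> MMs; apply: optimum_eq => //; exact: MinW_subset. Qed.

Let rivalMs : M <> Ms -> Ms \in rivals.
Proof.
by move=> MMs; rewrite inE optMs.1.1/=; apply/negP => /subset_optimum.
Qed.

(** If [M] were not [Ms], then [Ms] would be a rival, and [MinW Ms w <= MinW Mt u <= MinW M l <=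
    MinW M w] would force [M = Ms]. *)
Lemma stop_correct :
  rivals = finset.set0 \/ MinW Mt u <= MinW M l -> M = Ms.
Proof.
move=> stop; apply: contrapT => /rivalMs Msr.
have [r0|MtM] := stop; first by rewrite r0 inE in Msr.
have rn0 : rivals <> finset.set0 by move=> r0; rewrite r0 inE in Msr.
suff MMs : M = Ms by move: Msr; rewrite inE MMs subxx andbF.
apply: optimum_eq => //; apply: (le_trans _ lMw); apply: (le_trans _ MtM).
by apply: (le_trans _ ((argMt rn0).2 _ Msr)); exact: MinW_mono.
Qed.

(** Any infinite value of [a] or [b] compatible with the hypotheses makes the difference [-oo], so
    finite and infinite gaps are treated alike. *)
Let lt_sub (a b : \bar R) (x y z : R) :
  a <= x%:E -> y%:E < b -> (x - y <= z)%R -> a - b < z%:E.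
Proof.
move: a b => [a| |] [b| |]//=; rewrite ?lee_fin ?lte_fin ?ltNyr// => ax yb xyz.
lra.
Qed.

Lemma gapC_lt_rad (rad : 'I_n -> R) c d p :
    (forall e, u e = l e + 2 * rad e)%R ->
    rivals <> finset.set0 -> ~ (MinW Mt u <= MinW M l) ->
    is_argmin M l c -> is_argmin Mt l d ->
    is_argmax [set c; d]%SET rad p ->
  gapC F w Ms p < (4 * rad p)%:E.
Proof.
move=> ue rn0 nstop argc argd [pcd radp].
have radc : (rad c <= rad p)%R by apply: radp; rewrite !inE eqxx.
have radd : (rad d <= rad p)%R by apply: radp; rewrite !inE eqxx orbT.
have Mlc := MinW_argmin _ _ _ argc; have Mtld := MinW_argmin _ _ _ argd.
have [Mtr Mtmax] := argMt rn0.
have [MtF MMt] : Mt \in F /\ ~~ (M \subset Mt) by move: Mtr; rewrite inE => /andP.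
(* The failed stopping test gives [l c = MinW M l < MinW Mt u <= u d]. *)
have lcud : (l c < u d)%R.
  rewrite -lte_fin -Mlc; move/negP: nstop; rewrite -ltNge => /lt_le_trans; apply.
  exact/MinW_le/argd.1.
have ldlc : (l d <= l c)%R by rewrite -lee_fin -Mlc -Mtld; exact: argM.2.
have := ue c; have := ue d => ued uec.
have wp : (w p <= l c + 2 * rad p)%R.
  by move: pcd; rewrite !inE => /orP[]/eqP->; have := wu c; have := wu d; lra.
(* Since [l c < u d = l d + 2 * rad d], even the lower bounds of both super arms stay above
   [l c - 2 * rad p]. *)
have ltv M' : M' \in [set M; Mt]%SET -> (l c - 2 * rad p)%:E < MinW M' w.
  have ltM : (l c - 2 * rad p)%:E < (l d)%:E by rewrite lte_fin; lra.
  rewrite !inE => /orP[]/eqP->; apply: (lt_le_trans ltM).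
    by apply: le_trans lMw; rewrite Mlc lee_fin.
  by rewrite -Mtld; exact: MinW_mono.
have pM : exists2 M', M' \in [set M; Mt]%SET & p \in M'.
  move: pcd; rewrite !inE => /orP[]/eqP->; [exists M|exists Mt];
    rewrite ?inE ?eqxx ?orbT//; [exact: argc.1|exact: argd.1].
have inF M' : M' \in [set M; Mt]%SET -> M' \in F by rewrite !inE => /orP[]/eqP->.
have ltmax : (l c - 2 * rad p)%:E < maxMinW [set M' in F | p \in M']%SET w.
  have [M' M'in pM'] := pM; apply: (lt_le_trans (ltv _ M'in)).
  by apply: le_maxMinW; rewrite inE inF.
rewrite /gapC; case: ifPn => [pMs|pMs]; last case: ifPn => [_|_].
- apply: (@lt_sub _ _ (l c + 2 * rad p)%R (l c - 2 * rad p)%R);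
    [by rewrite lee_fin| |lra].
  (* [M] is not a subset of [Mt], so the two differ and at least one of them is not [Ms]. *)
  have [M' M'in M'Ms] : exists2 M', M' \in [set M; Mt]%SET & M' != Ms.
    have [MMs|] := eqVneq M Ms; [exists Mt|exists M]; rewrite ?inE ?eqxx ?orbT//.
    by apply: contraNneq MMt => ->; rewrite MMs.
  by apply: (lt_le_trans (ltv _ M'in)); apply: le_maxMinW; rewrite inE inF.
- by apply: (@lt_sub _ _ (l c + 2 * rad p)%R (l c - 2 * rad p)%R) => //; lra.
- apply: (@lt_sub _ _ (l c + 2 * rad p)%R (l c - 2 * rad p)%R) => //; last lra.
  (* The optimum is at most [w c] if [M = Ms]; otherwise [Ms] is a rival, so [Mt] does at least as
     well under [u] and the optimum is at most [u d]. *)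
  have [MMs|/eqP MMs] := eqVneq M Ms.
    rewrite -MMs; apply: (le_trans (MinW_le _ _ _ argc.1)); rewrite lee_fin.
    by have := wu c; lra.
  apply: (@le_trans _ _ (u d)%:E); last by rewrite lee_fin; lra.
  apply: (@le_trans _ _ (MinW Mt u)); last exact/MinW_le/argd.1.
  by apply: (le_trans _ (Mtmax _ (rivalMs MMs))); exact: MinW_mono.
Qed.

End unique_optimum.

(** * Solving the implicit inequality for the number of rounds *)

(** Applying [ln y <= y - 1] at [y = N / (192 * H)] bounds [H * ln N] by [N / 192] plus terms free
    of [N], so that half of [N] is absorbed on the left. *)
Lemma sample_complexity_arith (R : realType) (n H delta N : R) :
  1 <= n -> 0 <= H -> 0 < delta < 1 -> 0 < N ->
  N <= n + 32 * H * ln (4 * n * N ^+ 3 / delta) ->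
  N <= 10 ^+ 5 * Num.max n (H * ln (H * n / delta)).
Proof.
move=> n1 H_ge0 /andP[d0 d1] N0 hN; set B := H * ln _; set m := Num.max _ _.
have n0 : 0 < n by exact: lt_le_trans n1.
have nm : n <= m by rewrite le_max lexx.
have Bm : B <= m by rewrite le_max lexx orbT.
move: H_ge0; rewrite le_eqVlt => /predU1P[H0|H0].
  by move: hN; rewrite -H0 mulr0 mul0r addr0; lra.
have nd0 : 0 < n / delta by rewrite divr_gt0.
have lnnd : 0 <= ln (n / delta).
  by rewrite ln_ge0// ler_pdivlMr// mul1r; lra.
have BE : B = H * ln H + H * ln (n / delta).
  by rewrite /B -mulrA lnM ?posrE// mulrDr.
have ln_leB1 (y : R) : 0 < y -> ln y <= y - 1.
  by move=> y0; rewrite -[y in ln y](subrKC 1) le_ln1Dx//; lra.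
have Hi : 0 < H^-1 by rewrite invr_gt0.
have lnH : 1 - H^-1 <= ln H.
  have := ln_leB1 _ Hi; rewrite lnV ?posrE//; lra.
(* As [H * ln H <= B], this yields [H <= B + 1 <= 2 * m], which controls the terms linear in [H]. *)
have HlnH : H - 1 <= H * ln H.
  by move: (ler_wpM2l (ltW H0) lnH); rewrite mulrBr mulr1 divff ?gt_eqF.
have Hlnnd : 0 <= H * ln (n / delta) by rewrite mulr_ge0// ltW.
have ln4 : ln 4 <= 3 :> R.
  by have := ln_leB1 4; lra.
have ln192 : ln 192 <= 191 :> R.
  by have := ln_leB1 192; lra.
pose c : R := 192; have c0 : 0 < c by [].
have NH0 : 0 < N / (c * H) by rewrite divr_gt0// mulr_gt0.
have lnNH : ln N <= N / (c * H) - 1 + (ln c + ln H).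
  have := ln_leB1 _ NH0; rewrite lnM ?posrE ?invr_gt0 ?mulr_gt0//.
  rewrite lnV ?posrE ?mulr_gt0// lnM ?posrE//.
  lra.
(* the weight c = 6 * 32 makes the N-part of 3 * 32 * H * ln N equal to N / 2 *)
have HlnN : H * ln N <= N / c + H * 191 + H * ln H.
  apply: (le_trans (ler_wpM2l (ltW H0) lnNH)).
  have -> : H * (N / (c * H) - 1 + (ln c + ln H)) =
    N / c - H + H * ln c + H * ln H by field; rewrite !gt_eqF.
  have : H * ln c <= H * 191 by rewrite ler_pM2l.
  rewrite -/c; lra.
have lnE : ln (4 * n * N ^+ 3 / delta) = ln 4 + ln (n / delta) + 3 * ln N.
  rewrite (_ : 4 * n * N ^+ 3 / delta = 4 * (n / delta) * N ^+ 3); last by ring.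
  have nd4 : 0 < 4 * (n / delta) by rewrite mulr_gt0.
  rewrite lnM ?posrE ?exprn_gt0// lnM ?posrE//.
  by rewrite lnXn// mulr_natl.
have Hln4 : H * ln 4 <= H * 3 by rewrite ler_pM2l.
(* There remains [N / 2 <= n + 32 * (576 * H + H * ln (n / delta) + 3 * H * ln H)]. With
   [H <= 2 * m] and [H * ln H <= B <= m] the right side is at most [36961 * m], whence the constant
   [10 ^+ 5]. *)
move: hN; rewrite lnE -mulrA !mulrDr [H * (3 * _)]mulrCA.
move: HlnN; rewrite /c; lra.
Qed.

(** * Counting samples along a run on the confidence event *)

Section run.
Context {R : realType} {n : nat} {F : {set {set 'I_n}}} {sg delta : R}.
Context {w : 'I_n -> R} {Ms : {set 'I_n}} {x : 'I_n -> nat -> R} {z : trajectory n}.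
Hypothesis sg_gt0 : 0 < sg.
Hypothesis delta01 : 0 < delta < 1.
Hypothesis optMs : is_unique_optimum F w Ms.
Hypothesis run : BLUCB_run F sg delta x z.
(* Stated with [k + 1], the first round before which [k] samples can have been
   taken, so that it implies the bound with [t] at every round. *)
Hypothesis conf : forall e (k : nat), (0 < k)%N ->
  `|(\sum_(j < k) x e j) / k%:R - w e| <=
  sg * Num.sqrt (2 * ln (4 * n%:R * k.+1%:R ^+ 3 / delta) / k%:R).

Let n_ge1 : 1 <= n%:R :> R.
Proof. by rewrite ler1n; exact: leq_ltn_trans (ltn_ord (run_p z 0)). Qed.

Let delta_gt0 : 0 < delta. Proof. by case/andP: delta01. Qed.

Let ratio_gt1 (t : nat) : (0 < t)%N -> 1 < 4 * n%:R * t%:R ^+ 3 / delta.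
Proof.
move=> t0; case/andP: delta01 => _ d1.
have t1 : 1 <= t%:R ^+ 3 :> R by rewrite exprn_ege1// ler1n.
have := n_ge1; rewrite ltr_pdivlMr// mul1r; nra.
Qed.

Let ln_ratio_le (s t : nat) : (0 < s <= t)%N ->
  ln (4 * n%:R * s%:R ^+ 3 / delta) <= ln (4 * n%:R * t%:R ^+ 3 / delta).
Proof.
move=> /andP[s0 st]; have t0 := leq_trans s0 st.
rewrite ler_ln ?posrE ?(lt_trans ltr01 (ratio_gt1 _ _))//.
rewrite ler_pM2r ?invr_gt0// ler_pM2l; last by have := n_ge1; lra.
by rewrite lerXn2r ?nnegrE// ler_nat.
Qed.

Let num_samplesS t e : (0 < t)%N ->
  num_samples z t.+1 e = (num_samples z t e + (run_p z t == e))%N.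
Proof. by move=> t0; rewrite /num_samples big_nat_recr. Qed.

Let num_samples_lt t e : (0 < t)%N -> (num_samples z t e < t)%N.
Proof.
elim: t => [//|[_ _|t IH _]]; first by rewrite /num_samples big_geq.
rewrite num_samplesS// -addn1 -[X in (_ <= X)%N]addn1 leq_add2r.
rewrite -ltnS -(addn1 t.+1) -addSn leq_add//; first exact: IH.
exact: leq_b1.
Qed.

Let num_samples_gt0 t e : (n < t)%N -> (0 < num_samples z t e)%N.
Proof.
elim: t => [//|t IH]; rewrite ltnS leq_eqVlt => /predU1P[<-|nt].
  by rewrite run.1.
by rewrite num_samplesS ?(leq_ltn_trans _ nt)// addn_gt0 IH.
Qed.

Let sum_num_samples t : (\sum_e num_samples z t.+1 e = t)%N.
Proof.
rewrite /num_samples exchange_big/=.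
rewrite (eq_bigr (fun=> 1%N)) => [|s _]; last first.
  by rewrite (bigD1 (run_p z s))//= eqxx big1// => e /negPf; rewrite eq_sym => ->.
by rewrite sum_nat_const_nat muln1 subn1.
Qed.

(** An arm with [k] samples before round [t] has [k.+1 <= t], so the radius in [conf] is at most the
    one used in round [t]. *)
Let emp_mean_close t e : (n < t)%N ->
  `|emp_mean x z t e - w e| <= Defs.rad sg delta z t e.
Proof.
move=> nt; have k0 := num_samples_gt0 _ e nt; apply: (le_trans (conf e _ k0)).
rewrite /Defs.rad ler_pM2l// ler_sqrt; last first.
  by rewrite divr_ge0// mulr_ge0// ln_ge0// ltW// ratio_gt1 ?(leq_ltn_trans _ nt).
rewrite ler_pM2r ?invr_gt0 ?ltr0n// ler_pM2l// ln_ratio_le//=.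
by rewrite num_samples_lt// (leq_ltn_trans _ nt).
Qed.

Let lcb_le t e : (n < t)%N -> lcb sg delta x z t e <= w e.
Proof. by move=> nt; have := emp_mean_close _ e nt; rewrite /lcb ler_norml; lra. Qed.

Let ucb_ge t e : (n < t)%N -> w e <= ucb sg delta x z t e.
Proof. by move=> nt; have := emp_mean_close _ e nt; rewrite /ucb ler_norml; lra. Qed.

Lemma stop_run_correct t : (n < t)%N -> running F sg delta x z t ->
  stop_test F sg delta x z t -> run_M z t = Ms.
Proof.
move=> nt rt st; have [argM argMt _] := run.2 _ nt rt.
exact: (stop_correct optMs (fun e => lcb_le t e nt)
  (fun e => ucb_ge t e nt) argM argMt st).
Qed.

(** Squaring the bound of the gap by four radii gives a factor [16 * 2 = 32], and the result is
    solved for the sample count in the denominator. Being below a finite number, the gap cannot be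
    [+oo]. *)
Lemma num_samples_run_p_lt t : (n < t)%N -> running F sg delta x z t ->
    ~ stop_test F sg delta x z t ->
  (num_samples z t (run_p z t))%:R <
  32 * (sg ^+ 2 * inv_sq (gapC F w Ms (run_p z t))) *
  ln (4 * n%:R * t%:R ^+ 3 / delta).
Proof.
move=> nt rt nst; have [argM argMt /(_ nst)[argc argd argp]] := run.2 _ nt rt.
have rn0 : rivals F z t <> finset.set0 by move=> r0; apply: nst; left.
have nle : ~ (MinW (run_Mt z t) (ucb sg delta x z t) <=
              MinW (run_M z t) (lcb sg delta x z t))%E.
  by move=> le; apply: nst; right.
have ue e : ucb sg delta x z t e =
    lcb sg delta x z t e + 2 * Defs.rad sg delta z t e by rewrite /ucb /lcb; lra.
have := gapC_lt_rad optMs (fun e => lcb_le t e nt) (fun e => ucb_ge t e nt)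
  argM argMt _ _ _ _ ue rn0 nle argc argd argp.
have := gapC_gt0 optMs (run_p z t).
set p := run_p z t; case: gapC => [g| |]//; rewrite !lte_fin => g0 /= grad.
have T0 : 0 < (num_samples z t p)%:R :> R.
  by rewrite ltr0n; exact: num_samples_gt0.
have ln0 : 0 < ln (4 * n%:R * t%:R ^+ 3 / delta).
  by rewrite ln_gt0// ratio_gt1// (leq_ltn_trans _ nt).
have : g ^+ 2 < (4 * Defs.rad sg delta z t p) ^+ 2.
  by rewrite ltrXn2r// ?nnegrE ?ltW// (lt_trans g0 grad).
rewrite /Defs.rad !exprMn sqr_sqrtr; last by rewrite ltW// divr_gt0// mulr_gt0.
rewrite !mulrA ltr_pdivlMr// -ltr_pdivlMl ?exprn_gt0//.
by move/lt_le_trans; apply; rewrite le_eqVlt; apply/orP; left; apply/eqP; ring.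
Qed.

Let H := \sum_(e < n) sg ^+ 2 * inv_sq (gapC F w Ms e).

Let inv_sq_ge0 (y : \bar R) : 0 <= inv_sq y.
Proof. by case: y => [r| |]//=; rewrite invr_ge0 sqr_ge0. Qed.

(** The count grows only in rounds that play [e], and before such a play it is already bounded; the
    play itself adds the 1. Taking the logarithm at [N] makes the bound uniform over the rounds. *)
Lemma num_samples_le N t e : (n < t <= N.+1)%N -> running F sg delta x z N.+1 ->
  (num_samples z t e)%:R <= 1 +
  32 * (sg ^+ 2 * inv_sq (gapC F w Ms e)) * ln (4 * n%:R * N%:R ^+ 3 / delta).
Proof.
move=> ntN rN; set b := 32 * _; elim: t ntN => [//|t IH].
have b0 : 0 <= b by rewrite mulr_ge0// mulr_ge0// ?sqr_ge0.
rewrite ltnS leq_eqVlt => /andP[/predU1P[<-|nt] tN].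
  (* Base case: one sample after the initial rounds. For [N = 0] the logarithm is [ln 0], which is 0
     by convention. *)
  rewrite run.1 lerDl; have [->|N0] := posnP N; last first.
    by rewrite mulr_ge0// ln_ge0// ltW// ratio_gt1.
  by rewrite expr0n/= mulr0 mul0r ln0// mulr0.
have t0 : (0 < t)%N by exact: leq_ltn_trans nt.
rewrite num_samplesS//; case: eqVneq => [pe|_]; last first.
  by rewrite addn0 IH// nt ltnW.
rewrite natrD addrC lerD2l -pe.
have rt : running F sg delta x z t.
  by move=> s /andP[ns st]; apply: rN; rewrite ns (leq_trans st)// ltnW.
have nst : ~ stop_test F sg delta x z t by apply: rN; rewrite nt.
apply: (le_trans (ltW (num_samples_run_p_lt _ nt rt nst))).
by rewrite pe -/b ler_wpM2l// ln_ratio_le// t0.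
Qed.

Lemma running_bound N : (n <= N)%N -> running F sg delta x z N.+1 ->
  N%:R <= 10 ^+ 5 * Num.max n%:R (complexity_bound sg delta (gapC F w Ms)).
Proof.
move=> nN rN.
have N0 : (0 < N)%N by apply: leq_trans nN; rewrite -(ler1n R).
rewrite /complexity_bound -/H.
have -> : \sum_(e < n) sg ^+ 2 * n%:R * inv_sq (gapC F w Ms e) / delta =
    H * n%:R / delta.
  by rewrite /H !mulr_suml; apply: eq_bigr => e _; ring.
apply: sample_complexity_arith => //.
- by apply: sumr_ge0 => e _; rewrite mulr_ge0// sqr_ge0.
- by rewrite ltr0n.
rewrite -[in leLHS](sum_num_samples N) natr_sum.
apply: (@le_trans _ _ (\sum_(e < n) (1 +
  32 * (sg ^+ 2 * inv_sq (gapC F w Ms e)) * ln (4 * n%:R * N%:R ^+ 3 / delta)))).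
  by apply: ler_sum => e _; apply: num_samples_le => //; rewrite ltnS nN leqnn.
by rewrite big_split/= sumr_const card_ord -mulr_suml -mulr_sumr.
Qed.

(** A run that never stopped would satisfy [running_bound] for arbitrarily large [N]. Hence a
    stopping round exists, and the algorithm returns at the least one. *)
Lemma run_returns : exists N,
  BLUCB_returns F sg delta x z Ms N /\
  N%:R <= 10 ^+ 5 * Num.max n%:R (complexity_bound sg delta (gapC F w Ms)).
Proof.
set C := 10 ^+ 5 * _.
have stops : exists t, (n < t)%N && `[< stop_test F sg delta x z t >].
  apply: contrapT => nstop.
  have rN N : running F sg delta x z N.+1.
    move=> s /andP[ns _] st; apply: nstop; exists s.
    by rewrite ns; exact/asboolP.
  have C0 : 0 <= C.
    by rewrite mulr_ge0// le_max; apply/orP; left.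
  pose N := maxn n (Num.truncn C).+1.
  have := running_bound N (leq_maxl _ _) (rN N).
  rewrite leNgt => /negP; apply; apply: (lt_le_trans (truncnS_gt _)).
  by rewrite ler_nat leq_maxr.
case: (ex_minnP stops) => -[//|N] /andP[nN /asboolP sN] minN.
have rN : running F sg delta x z N.+1.
  move=> s /andP[ns sN'] st; have := minN s; rewrite ns leqNgt sN'/=.
  by move=> /(_ (asboolT st)).
exists N; split; last exact: running_bound.
by split => //; exact: stop_run_correct.
Qed.

End run.

(** * Transfer of integrals between a reward and its law *)

Section change_of_display.
Context {R : realType} {d : measure_display} {Omega : measurableType d}.
Context {P : probability Omega R} (Y : {RV P >-> R}).
Context (nu : probability (measurableTypeR R) R).

Let idTR : measurableTypeR R -> R := idfun.

Let measurable_idTR : measurable_fun setT idTR.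
Proof. exact: (@measurable_id _ (measurableTypeR R) setT). Qed.

(* [nu] and [distribution P Y] live on two copies of the Borel space that carry
   different displays, so they are compared through a pushforward along the
   identity. *)
Lemma integral_distributionE (f : R -> \bar R) :
    measurable_fun setT f -> (forall y, 0 <= f y)%E ->
    (forall A : set (measurableTypeR R), measurable A ->
      distribution P Y A = nu A) ->
  (\int[P]_om f (Y om) = \int[nu]_y f y)%E.
Proof.
move=> mf f0 Ynu; rewrite -(ge0_integral_distribution Y mf f0).
rewrite -[RHS](ge0_integral_pushforward measurable_idTR nu measurableT mf)//.
by apply: eq_measure_integral => A mA _; exact: Ynu.
Qed.

End change_of_display.

(** * Correctness and sample complexity of BLUCB with high probability *)

Theorem theorem1 (R : realType) :
  exists C : R, 0 < C /\
  forall (n : nat) (sg delta : R) (w : 'I_n -> R)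
    (nu : 'I_n -> probability (measurableTypeR R) R)
    (F : {set {set 'I_n}}) (Ms : {set 'I_n})
    (d : measure_display) (Omega : measurableType d) (P : probability Omega R)
    (X : 'I_n * nat -> {RV P >-> R}) (run : Omega -> trajectory n),
  0 < sg -> 0 < delta < 1 ->
  (forall e, has_mean (nu e) (w e)) ->
  (forall e, sub_gaussian (nu e) (w e) sg) ->
  finset.set0 \notin F ->
  is_unique_optimum F w Ms ->
  iid_samples nu X ->
  (forall om, BLUCB_run F sg delta (fun e k => X (e, k) om) (run om)) ->
  exists E : set Omega,
    [/\ measurable E,
        ((1 - delta)%:E <= P E)%E
      & forall om, E om -> exists N : nat,
          BLUCB_returns F sg delta (fun e k => X (e, k) om) (run om) Ms N /\
          N%:R <= C * Num.max n%:R (complexity_bound sg delta (gapC F w Ms))].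
Proof.
exists (10 ^+ 5); split; first exact: exprn_gt0.
move=> n sg delta w nu F Ms d Omega P X run sg0 /andP[d0 d1] _ nu_sg _ optMs
  [indep X_nu] runP.
(* The tail assumption on [nu e] passes to every reward of [e] through its law. *)
have X_sg i lam : (\int[P]_om (expR (lam * (X i om - w i.1)))%:E <=
    (expR (lam ^+ 2 * sg ^+ 2 / 2))%:E)%E.
  case: i => e k /=; apply: le_trans (nu_sg e lam).
  pose f (y : R) := (expR (lam * (y - w e)))%:E.
  have mf : measurable_fun setT (f : R -> \bar R).
    apply/measurable_EFinP; apply: measurableT_comp => //.
    by apply: measurable_funM => //; exact: measurable_funB.
  have f0 y : (0 <= f y)%E by rewrite lee_fin expR_ge0.
  by rewrite (integral_distributionE (X (e, k)) (nu e) f mf f0 (X_nu e k)).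
have [E [mE PE confE]] := confidence_event sg0 d0 d1 indep X_sg.
exists E; split => // om Eom.
apply: run_returns => //; first by rewrite d0.
exact: confE.
Qed.
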